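(* Let $k,d\ge1$ be integers, $G=\mathbb{Z}_2^{kd}$, $\Gamma=\widehat{G}$, and let $K:\Gamma\times\Gamma\to\mathbb{C}$ be the kernel $$K(a,b)=\varphi(a-b)=\sum_{l=(k_1,\dots,k_d)\in\mathbb{N}^d,\ |l|=k}\frac{1}{d^k}\binom{k}{l}\prod_{j=1}^d\prod_{i=1}^{k_j}\chi\big(a^j_i=b^j_i\big).$$ Let $E_K=\mathrm{supp}(\check\varphi)\subseteq G$. Then: (i) as a linear space, $H_K=L_{E_K}$, where $$E_K=\big\{x=(x^1|\dots|x^d)\in G:\ \text{there is } l=(k_1,\dots,k_d)\in\mathbb{N}^d \text{ with } k_1+\dots+k_d=k \text{ such that } x^j_i=0 \text{ for all } 1\le j\le d,\ k_j+1\le i\le k\big\};$$ (ii) for $x\in E_K$, $$\check\varphi(x)=\frac{1}{2^k d^k}\sum_{l}\binom{k}{l},$$ where the sum is over all $l=(k_1,\dots,k_d)\in\mathbb{N}^d$ with $|l|=k$ such that $x^j_i=0$ for all $1\le j\le d$ and $k_j+1\le i\le k$.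
   Context: $\mathbb{N}$ includes $0$; $|l|=k_1+\dots+k_d$; $\binom{k}{l}=\frac{k!}{k_1!\cdots k_d!}$; $\chi(P)=1$ if $P$ holds and $0$ otherwise. Elements of $G=\mathbb{Z}_2^{kd}$ are written as $k\times d$ binary matrices $x=(x_i^j)_{1\le i\le k,\,1\le j\le d}=(x^1|\dots|x^d)$ with columns $x^j$. The dual group $\Gamma=\widehat G$ is identified with $\mathbb{Z}_2^{kd}$, elements $a=(a_i^j)$, with characters $\gamma_a(x)=(-1)^{a\cdot x}$, $a\cdot x=\sum_{i,j}a_i^jx_i^j$. Since the kernel $K(a,b)$ depends only on $a-b$, it defines $\varphi:\Gamma\to\mathbb{R}$ by $K(a,b)=\varphi(a-b)$. For $\psi:\Gamma\to\mathbb{C}$, $\check\psi:G\to\mathbb{C}$ is $\check\psi(x)=\frac{1}{\sharp(\Gamma)}\sum_{a\in\Gamma}\psi(a)\gamma_a(x)$. For $E\subseteq G$, $L_E=\{\psi:\Gamma\to\mathbb{C}:\ \mathrm{supp}(\check\psi)\subseteq E\}$. $H_K=\mathrm{span}\{K_b:\ b\in\Gamma\}$, $K_b(a)=K(a,b)$, is the Hilbert space of functions on $\Gamma$ having $K$ as reproducing kernel. *)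

(* Defs.v *)
(* The complex numbers are R[i], for R : realType. *)
From mathcomp Require Import all_boot all_order all_algebra.
From mathcomp Require Import complex reals.

Set Implicit Arguments.
Unset Strict Implicit.
Unset Printing Implicit Defensive.

Import Order.TTheory GRing.Theory Num.Theory.
Local Open Scope ring_scope.
Local Open Scope complex_scope.

(* Z_2^(kd), and also its dual group. Row and column indices are 0-based:
   [x i j] is the entry x_(i+1)^(j+1). *)
Notation binmx k d := 'M['Z_2]_(k, d).

(* [R[i]^o] is the field [R[i]] seen as a vector space over itself. *)
Notation cfun R k d := {ffun binmx k d -> R[i]^o}.

Section Fourier.
Variables (R : realType) (k d : nat).
Implicit Types (a x : binmx k d) (f psi : cfun R k d) (E : {set binmx k d}).

Definition dot a x : 'Z_2 := \sum_(i < k) \sum_(j < d) a i j * x i j.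

Definition gamma a x : R[i] := (-1) ^+ (dot a x : nat).

(* The inverse Fourier transform of [psi]. *)
Definition check psi : cfun R k d :=
  [ffun x => #|{: binmx k d}|%:R^-1 * \sum_(a : binmx k d) psi a * gamma a x].

Definition supp f : {set binmx k d} := [set x | f x != 0].

Definition L E : {pred cfun R k d} :=
  [pred psi : cfun R k d | supp (check psi) \subset E].

End Fourier.

Section Kernel.
Variables (R : realType) (k d : nat).
Implicit Types (a b x : binmx k d).

(* The multi-indices l in N^d with |l| = k: every entry of such an l is at
   most k, so they are the functions into ['I_k.+1] with sum k. *)
Definition comps : {set {ffun 'I_d -> 'I_k.+1}} :=
  [set l : {ffun 'I_d -> 'I_k.+1} | (\sum_j l j)%N == k].

Definition multinomial (l : {ffun 'I_d -> 'I_k.+1}) : R[i] :=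
  k`!%:R / \prod_j (l j)`!%:R.

(* The 1-based range 1 <= i <= k_j reads i < k_j with 0-based rows. *)
Definition K a b : R[i] :=
  \sum_(l in comps) (d%:R ^+ k)^-1 * multinomial l *
    \prod_(j < d) \prod_(i < k | (i < l j)%N) (a i j == b i j)%:R.

(* The function determined by K(a, b) = phi(a - b), see [K_phi]. *)
Definition phi : cfun R k d := [ffun a => K a 0].

Lemma K_phi a b : K a b = phi (a - b).
Proof.
rewrite ffunE; apply: eq_bigr => l _; congr (_ * _).
apply: eq_bigr => j _; apply: eq_bigr => i _.
by rewrite !mxE subr_eq0.
Qed.

Definition K_at b : cfun R k d := [ffun a => K a b].

Definition H_K : {vspace cfun R k d} := <<codom K_at>>%VS.

Definition E_K : {set binmx k d} := supp (check phi).

(* x^j_i = 0 whenever k_j + 1 <= i <= k, i.e. k_j <= i with 0-based rows. *)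
Definition vanishes_beyond (l : 'I_d -> nat) x : bool :=
  [forall j : 'I_d, forall i : 'I_k, (l j <= i)%N ==> (x i j == 0)].

End Kernel.

(* Main.v *)
Require Import Defs.
From mathcomp Require Import all_boot all_order all_algebra.
From mathcomp Require Import complex reals.

(** The kernel depends only on a - b, so the Fourier transform diagonalizes it
    and the theorem reduces to the computation of check phi, [check_phi].

    For a fixed multi-index l, the product of indicators in [K] is the
    indicator of the matrices a that vanish at the k positions (i, j) with
    i < l j. Summing it against a character splits into one factor for each
    matrix entry ([sum_gamma_vanishing]): an entry where a is forced to be 0
    contributes 1, a free entry contributes 1 + (-1)^(x i j), that is, 2 if
    x i j = 0 and 0 otherwise. The result is 2^(kd - k) if x vanishes at all
    the free positions and 0 if it does not, which gives (ii) after division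
    by the order 2^(kd) of the group. All terms of the sum over l in (ii) are
    positive, so it is nonzero exactly when some l contributes: this is the
    description of E_K, [mem_E_K].

    For H_K = L(E_K), see [H_K_eq_L]: a translate K_b has inverse transform
    gamma_b * check phi, supported in E_K, and L(E_K) is a linear space.
    Conversely, convolving phi with gamma_x gives a nonzero multiple of gamma_x
    for x in E_K, so these characters lie in H_K ([sum_gamma_K_at]), and
    Fourier inversion writes every element of L(E_K) as a combination of
    them. *)

Local Open Scope ring_scope.
Local Open Scope complex_scope.

Import Order.TTheory GRing.Theory Num.Theory.

Section Characters.
Context {R : realType} {k d : nat}.
Implicit Types (a b x : binmx k d) (psi : cfun R k d).

Lemma Z2_cases (s : 'Z_2) : s = 0 \/ s = 1.
Proof. by case: s => [[|[|//]] ?]; [left|right]; apply: val_inj. Qed.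

Definition signZ2 (s : 'Z_2) : R[i] := (-1) ^+ (s : nat).

Lemma signZ2D : {morph signZ2 : s t / s + t >-> s * t}.
Proof.
by move=> s t; rewrite /signZ2; case: (Z2_cases s) (Z2_cases t) => -> [] -> /=;
  rewrite ?expr0 ?expr1 ?mulr1 ?mul1r ?mulrNN ?mulr1.
Qed.

Lemma gamma_prod a x :
  gamma R a x = \prod_(p : 'I_k * 'I_d) signZ2 (a p.1 p.2 * x p.1 p.2).
Proof.
rewrite /gamma /dot pair_big -/(signZ2 _) /=.
apply: (big_morph _ signZ2D); exact: expr0.
Qed.

Lemma gammaC a x : gamma R a x = gamma R x a.
Proof. by rewrite !gamma_prod; apply: eq_bigr => p _; rewrite mulrC. Qed.

Lemma gammaD a b x : gamma R (a + b) x = gamma R a x * gamma R b x.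
Proof.
rewrite !gamma_prod -big_split; apply: eq_bigr => p _.
by rewrite mxE mulrDl signZ2D.
Qed.

Lemma sum_signZ2 (t : 'Z_2) :
  \sum_(s : 'Z_2) signZ2 (s * t) = 2%:R * (t == 0)%:R :> R[i].
Proof.
rewrite big_ord_recl big_ord1; case: (Z2_cases t) => -> /=.
  by rewrite mulr1.
by rewrite mulr0 subrr.
Qed.

Lemma prod_indicator (I : finType) (P B : pred I) :
  \prod_(i | P i) (B i)%:R = [forall (i | P i), B i]%:R :> R[i].
Proof.
rewrite -big_andE; symmetry; apply: (big_morph (fun b : bool => b%:R)) => //.
by move=> b c; rewrite -natrM mulnb.
Qed.

(** Expanding the right-hand side chooses one bit for each position, that is,
    a matrix. *)
Lemma sum_mx_prod (F : 'I_k * 'I_d -> 'Z_2 -> R[i]) :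
  \sum_(a : binmx k d) \prod_p F p (a p.1 p.2) = \prod_p \sum_s F p s.
Proof.
rewrite bigA_distr_bigA /= (reindex (fun f : {ffun _} => Matrix f)) /=.
  by apply: eq_bigr => f _; apply: eq_bigr => -[i j] _; rewrite /fun_of_matrix.
by exists (fun A => mx_val A) => // -[].
Qed.

(** The only Fourier computation needed: the transform of the indicator of a
    coordinate subspace is a multiple of the indicator of its annihilator. With
    [P] empty it is the orthogonality of characters, and with [P] the positions
    i < l j it is the transform of one term of the kernel. *)
Lemma sum_gamma_vanishing (P : pred ('I_k * 'I_d)) x :
  \sum_(a : binmx k d) (\prod_(p | P p) (a p.1 p.2 == 0)%:R) * gamma R a x =
  2%:R ^+ #|[predC P]| * [forall (p | ~~ P p), x p.1 p.2 == 0]%:R.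
Proof.
pose F p (s : 'Z_2) : R[i] :=
  (if P p then (s == 0)%:R else 1) * signZ2 (s * x p.1 p.2).
rewrite (eq_bigr (fun a => \prod_p F p (a p.1 p.2))); last first.
  by move=> a _; rewrite big_split -big_mkcond gamma_prod.
rewrite sum_mx_prod -prod_indicator -prodr_const -big_split /=.
rewrite [RHS]big_mkcond; apply: eq_bigr => p _; rewrite /F !inE.
change (p \in P) with (P p).
case: (P p) => /=.
  rewrite (bigD1 0) //= big1 ?addr0 ?mul0r ?mul1r // => s /negPf ->.
  by rewrite mul0r.
by rewrite -sum_signZ2; apply: eq_bigr => s _; rewrite mul1r.
Qed.

Lemma card_binmx_neq0 : #|{: binmx k d}|%:R != 0 :> R[i].
Proof. by rewrite pnatr_eq0 -lt0n; apply/card_gt0P; exists 0. Qed.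

Lemma card_binmxE : #|{: binmx k d}| = (2 ^ (k * d))%N.
Proof. by rewrite card_mx card_ord. Qed.

Lemma sum_gamma x :
  \sum_a gamma R a x = #|{: binmx k d}|%:R * (x == 0)%:R.
Proof.
have := sum_gamma_vanishing pred0 x.
rewrite (eq_bigr (fun a => gamma R a x)); last first.
  by move=> a _; rewrite big_pred0_eq mul1r.
move=> ->; rewrite card_binmxE natrX; congr (2%:R ^+ _ * _%:R).
  by rewrite (eq_card (B := predT)) // card_prod !card_ord.
congr nat_of_bool; apply/forall_inP/eqP => [x0|-> p _]; last by rewrite mxE.
by apply/matrixP => i j; rewrite mxE; apply/eqP/(x0 (i, j)).
Qed.

(** Characteristic 2: every character is real and is its own inverse, so no
    complex conjugation appears in the inversion formula below. *)
Lemma oppmx_Z2 a : - a = a.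
Proof.
apply/matrixP => i j; rewrite !mxE.
by case: (Z2_cases (a i j)) => ->; apply/val_inj.
Qed.

Lemma addmx_eq0 a b : (a + b == 0) = (a == b).
Proof. by rewrite addr_eq0 oppmx_Z2. Qed.

(** Unfolds [check] with the sum taken in the field R[i] rather than in its
    copy R[i]^o, so that the lemmas on big operators apply on both sides of an
    equation. *)
Lemma checkE psi x :
  check psi x =
  #|{: binmx k d}|%:R^-1 * \sum_a psi a * gamma R a x :> R[i].
Proof. by rewrite ffunE. Qed.

Lemma Fourier_inversion psi a :
  psi a = \sum_x check psi x * gamma R a x :> R[i].
Proof.
under eq_bigr do rewrite checkE -mulrA mulr_suml.
rewrite -mulr_sumr exchange_big /= (bigD1 a) //=.
rewrite [X in _ + X]big1 ?addr0 => [|b neq_ba].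
  under eq_bigr do rewrite -mulrA -gammaD gammaC.
  rewrite -mulr_sumr sum_gamma addmx_eq0 eqxx mulr1 mulrCA mulVf ?mulr1 //.
  exact: card_binmx_neq0.
under eq_bigr do rewrite -mulrA -gammaD gammaC.
by rewrite -mulr_sumr sum_gamma addmx_eq0 (negPf neq_ba) !mulr0.
Qed.

Lemma in_LP (E : {set binmx k d}) psi :
  reflect (forall x, x \notin E -> check psi x = 0) (psi \in L E).
Proof.
rewrite inE; apply: (iffP subsetP) => [sE x xE | h x].
  by apply/eqP; apply: contraNT xE => nz; apply: sE; rewrite inE.
by rewrite inE; apply: contraNT => /h ->; rewrite eqxx.
Qed.

Lemma check_sum (I : finType) (c : I -> R[i]) (f : I -> cfun R k d) x :
  check (\sum_i c i *: f i) x = \sum_i c i * check (f i) x.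
Proof.
rewrite ffunE; under eq_bigr do rewrite sum_ffunE mulr_suml.
rewrite exchange_big mulr_sumr; apply: eq_bigr => i _.
rewrite ffunE mulrCA; congr (_ * _); rewrite mulr_sumr; apply: eq_bigr => a _.
by rewrite ffunE mulrA.
Qed.

(** Translation becomes modulation under the Fourier transform. *)
Lemma check_K_at b x :
  check (K_at R b) x = gamma R b x * check (phi R k d) x :> R[i].
Proof.
rewrite !checkE mulrCA; congr (_ * _).
rewrite (reindex_inj (addIr b)) mulr_sumr. apply: eq_bigr => a _.
by rewrite [K_at R b _]ffunE K_phi addrK gammaD mulrA [LHS]mulrC.
Qed.

(** The characters are the eigenvectors of the convolution operator with
    kernel [K]; the eigenvalue at x is nonzero exactly for x in E_K. *)
Lemma sum_gamma_K_at x a :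
  \sum_b gamma R b x * K R a b =
  #|{: binmx k d}|%:R * check (phi R k d) x * gamma R a x.
Proof.
rewrite checkE mulrA mulfV ?card_binmx_neq0 // mul1r mulr_suml.
rewrite (reindex_inj (addrI a)); apply: eq_bigr => b _.
rewrite K_phi opprD addNKr oppmx_Z2 gammaD.
by rewrite mulrC [gamma R a x * _]mulrC mulrA.
Qed.

Lemma H_K_eq_L : H_K R k d =i L (E_K R k d).
Proof.
move=> psi; apply/idP/in_LP => [psiH x xE | psi0].
  rewrite (coord_span (X := in_tuple _) psiH) check_sum big1 // => i _.
  have /codomP[b ->] :
      (in_tuple (codom (@K_at R k d)))`_i \in codom (@K_at R k d).
    exact: mem_nth.
  by move: xE; rewrite check_K_at inE negbK => /eqP ->; rewrite !mulr0.
(* Invert the eigenvalue of each gamma_x that occurs in psi: the inner sum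
     below is the function N * check phi x * gamma_x. *)
pose N : R[i] := #|{: binmx k d}|%:R.
have -> : psi = \sum_(x in E_K R k d)
    (check psi x / (N * check (phi R k d) x)) *:
      \sum_b gamma R b x *: K_at R b.
  apply/ffunP => a.
  rewrite {1}(Fourier_inversion psi a) (bigID (mem (E_K R k d))) /=.
  rewrite [X in _ + X]big1 ?addr0 => [|x /psi0 ->]; last by rewrite mul0r.
  rewrite sum_ffunE; apply: eq_bigr => x; rewrite inE => nz.
  rewrite [X in _ = X]ffunE sum_ffunE.
  rewrite (eq_bigr (fun b => gamma R b x * K R a b)); last first.
    by move=> b _; rewrite !ffunE.
  rewrite sum_gamma_K_at -[RHS]/(_ * _) mulrA divfK //.
  by rewrite mulf_neq0 // card_binmx_neq0.
apply: memv_suml => x _; apply: memvZ; apply: memv_suml => b _; apply: memvZ.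
exact/memv_span/codom_f.
Qed.

Lemma card_below (l : 'I_d -> nat) : (forall j, l j <= k)%N ->
  #|[pred p : 'I_k * 'I_d | (p.1 < l p.2)%N]| = (\sum_j l j)%N.
Proof.
move=> le_lk; rewrite -sum1_card.
rewrite (eq_bigl (fun p : 'I_k * 'I_d => true && (p.1 < l p.2)%N)) //.
rewrite -(pair_big_dep predT (fun (i : 'I_k) (j : 'I_d) => (i < l j)%N)
            (fun _ _ => 1%N)) /=.
rewrite (exchange_big_dep predT) //=; apply: eq_bigr => j _.
rewrite -(big_ord_widen k (fun=> 1%N)) //.
by rewrite sum1_card card_ord.
Qed.

(** Outside E_K both sides are 0, and it is this case that makes the
    formula also determine the support of check phi. *)
Lemma check_phi x : check (phi R k d) x =
  (2%:R ^+ k * d%:R ^+ k)^-1 *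
    \sum_(l in comps k d | vanishes_beyond (fun j => l j : nat) x)
      multinomial R l :> R[i].
Proof.
rewrite checkE big_mkcondr /=.
under eq_bigr do rewrite [phi R k d _]ffunE mulr_suml.
rewrite exchange_big /= mulr_sumr [RHS]mulr_sumr.
apply: eq_bigr => l; rewrite inE => /eqP sum_l.
pose P (p : 'I_k * 'I_d) := (p.1 < l p.2)%N.
rewrite (eq_bigr (fun a => ((d%:R ^+ k)^-1 * multinomial R l) *
   (\prod_(p | P p) (a p.1 p.2 == 0)%:R * gamma R a x))); last first.
  move=> a _; rewrite -!mulrA; congr (_ * (_ * (_ * _))).
  under eq_bigr do under eq_bigr do rewrite mxE.
  by rewrite (exchange_big_dep predT) //= pair_big_dep.
rewrite -mulr_sumr sum_gamma_vanishing card_binmxE natrX.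
have le_lk j : (l j <= k)%N by rewrite -ltnS.
(* The power 2^(kd) in the normalization exceeds that of the free positions
   by 2^k, because |l| = k positions are forced. *)
have cardP : (k + #|[predC P]| = k * d)%N.
  by rewrite -{1}sum_l -card_below // cardC card_prod !card_ord.
have -> : [forall (p | ~~ P p), x p.1 p.2 == 0] =
          vanishes_beyond (fun j => l j : nat) x.
  apply/forall_inP/forallP => [x0 j|x0 [i j]].
    by apply/forall_inP => i le_li; apply: (x0 (i, j)); rewrite /P -leqNgt.
  by rewrite /P -leqNgt => le_li; apply: (forall_inP (x0 j)).
rewrite -cardP exprD; case: vanishes_beyond; last by rewrite !mulr0.
have pow2_neq0 : 2%:R ^+ #|[predC P]| != 0 :> R[i].
  by rewrite expf_neq0 ?pnatr_eq0.
by rewrite mulr1 !invfM [X in _ * X]mulrC -mulrA mulKf // mulrA.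
Qed.

Lemma multinomial_gt0 (l : {ffun 'I_d -> 'I_k.+1}) : 0 < multinomial R l :> R[i].
Proof.
apply: divr_gt0; first by rewrite ltr0n fact_gt0.
by apply: prodr_gt0 => j _; rewrite ltr0n fact_gt0.
Qed.

(** No cancellation can occur in the sum of [check_phi], since multinomial
    coefficients are positive. *)
Lemma mem_E_K x : (0 < d)%N -> (x \in E_K R k d <->
  exists l : 'I_d -> nat, (\sum_(j < d) l j)%N = k /\ vanishes_beyond l x).
Proof.
move=> d_gt0; rewrite inE check_phi mulf_eq0 invr_eq0 mulf_eq0 !expf_eq0.
rewrite !pnatr_eq0 (gtn_eqF d_gt0) !andbF /=.
rewrite psumr_eq0 => [|l _]; last exact/ltW/multinomial_gt0.
split=> [/allPn[l _]|[l [sum_l lx]]].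
  rewrite negb_imply inE => /andP[/andP[/eqP sum_l lx] _].
  by exists (fun j => l j : nat).
(* The entries of l are at most their sum k, so l is one of the bounded
   multi-indices that index the sum. *)
have le_lk j : (l j <= k)%N by rewrite -sum_l (bigD1 j) ?leq_addr.
pose f : {ffun 'I_d -> 'I_k.+1} := [ffun j => inord (l j)].
have fE j : f j = l j :> nat by rewrite ffunE inordK ?ltnS ?le_lk.
apply/allPn; exists f; first by rewrite mem_index_enum.
rewrite negb_imply gt_eqF ?multinomial_gt0 // andbT inE.
under eq_bigr do rewrite fE.
rewrite sum_l eqxx /=; apply/forallP => j; rewrite fE.
exact: (forallP lx).
Qed.

End Characters.

Theorem theorem6 (R : realType) (k d : nat) (hk : (1 <= k)%N) (hd : (1 <= d)%N) :
  [/\ H_K R k d =i L (E_K R k d),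
      (forall x : binmx k d,
         x \in E_K R k d <->
         exists l : 'I_d -> nat,
           (\sum_(j < d) l j)%N = k /\ vanishes_beyond l x)
    & (forall x : binmx k d, x \in E_K R k d ->
         check (phi R k d) x =
         (2%:R ^+ k * d%:R ^+ k)^-1 *
           \sum_(l in comps k d | vanishes_beyond (fun j => l j : nat) x)
             multinomial R l)].
Proof.
split=> [|x|x _]; [exact: H_K_eq_L | exact: mem_E_K | exact: check_phi].
Qed.
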